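(* Let $N\ge 1$, $p\ge 1$ and $N^*\ge N$ be integers. Let $\mathcal{I}_{N,p}$ be the set of fixed point free involutions of $\{1,2,\dots,2N\}$ (i.e. permutations consisting solely of two-cycles) whose maximum decreasing subsequence length is less than or equal to $2p$. Then each of the following two sets of random turns vicious walker configurations on the half line lattice $\{l\in\mathbb{Z}: l\ge 1\}$ is in bijection with $\mathcal{I}_{N,p}$: (first class) the set of all walker configurations of $2N$ steps with exactly $p$ walkers, which start on the sites $l=1,2,\dots,p$ and after $2N$ steps have returned to their initial sites; (second class) the set of all walker configurations of $2N$ steps with exactly $N^*$ walkers, which start on the sites $l=1,2,\dots,N^*$ and after $2N$ steps have returned to their initial sites, and for which the right-most walker is, at every time, displaced by no more than $p$ lattice sites from its initial position.
   Context: Random turns vicious walker configurations: a configuration of $m$ walkers with $n$ steps, confined to $l\ge 1$, is a sequence of $n+1$ position vectors $(l_1(t),\dots,l_m(t))\in\mathbb{Z}^m$, $t=0,1,\dots,n$, with $1\le l_1(t)<l_2(t)<\cdots<l_m(t)$ for every $t$, such that at each time step $t-1\to t$ exactly one walker moves, and it moves by exactly one lattice site to the left or to the right (so necessarily onto a vacant site $l \ge 1$), all other walkers staying put. The right-most walker is the one with position $l_m(t)$, and its displacement at time $t$ is $l_m(t)-l_m(0)$. A decreasing subsequence of length $k$ of a permutation $\sigma$ of $\{1,\dots,2N\}$ is a choice of indices $a_1<\cdots<a_k$ with $\sigma(a_1)>\cdots>\sigma(a_k)$. *)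

(* Defs.v *)
From mathcomp Require Import all_boot all_order all_fingroup all_algebra.

Set Implicit Arguments.
Unset Strict Implicit.
Unset Printing Implicit Defensive.

Import Order.TTheory GRing.Theory Num.Theory.
Local Open Scope ring_scope.

(* Indices in ordinal types start from 0: walker [i : 'I_m] is the (i+1)-st
   walker from the left, and {1, ..., n} is encoded as 'I_n by k |-> k - 1. *)

Definition positions (m : nat) : Type := {ffun 'I_m -> int}.

Definition trajectory (n m : nat) : Type := {ffun 'I_n.+1 -> positions m}.

Definition admissible (m : nat) (x : positions m) : bool :=
  [forall i, 1%:Z <= x i] &&
  [forall i : 'I_m, forall j : 'I_m, (i < j)%N ==> (x i < x j)].

Definition random_turns_step (m : nat) (x y : positions m) : bool :=
  [exists i, (`|y i - x i| == 1) && [forall j, (j != i) ==> (y j == x j)]].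

(* Step [t : 'I_n] goes from time t, [widen_ord (leqnSn n) t], to time t + 1,
   [lift ord0 t]. *)
Definition walker_configuration (n m : nat) (w : trajectory n m) : bool :=
  [forall t, admissible (w t)] &&
  [forall t : 'I_n,
     random_turns_step (w (widen_ord (leqnSn n) t)) (w (lift ord0 t))].

Definition packed (m : nat) : positions m := [ffun i : 'I_m => (i.+1)%:Z].

Definition packed_return (n m : nat) (w : trajectory n m) : bool :=
  [&& walker_configuration w, w ord0 == packed m & w ord_max == packed m].

(* The right-most walker is the [i : 'I_m] with [i.+1 = m]. *)
Definition rightmost_displacement_le (n m p : nat) (w : trajectory n m) : bool :=
  [forall t, forall i : 'I_m, (i.+1 == m) ==> (w t i - w ord0 i <= p%:Z)].

Definition decreasing_subsequence (n k : nat) (s : 'S_n) (a : k.-tuple 'I_n) :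
    bool :=
  sorted (fun i j : 'I_n => (i < j)%N) a &&
  sorted (fun i j : 'I_n => (s j < s i)%N) a.

(* The indices of a subsequence are distinct, so its length is at most n. *)
Definition max_decreasing_length (n : nat) (s : 'S_n) : nat :=
  \max_(k < n.+1 | [exists a : k.-tuple 'I_n, decreasing_subsequence s a]) k.

Definition fixed_point_free_involution (n : nat) (s : 'S_n) : bool :=
  [forall i, (s (s i) == i) && (s i != i)].

Definition involutions_class (N p : nat) : Type :=
  {s : 'S_(2 * N) |
    fixed_point_free_involution s && (max_decreasing_length s <= 2 * p)%N}.

Definition first_class (N p : nat) : Type :=
  {w : trajectory (2 * N) p | packed_return w}.

Definition second_class (N Nstar p : nat) : Type :=
  {w : trajectory (2 * N) Nstar |
    packed_return w && rightmost_displacement_le p w}.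

(* Main.v *)
(** Writing the positions of the walkers as a partition added to the packed
    configuration turns both classes into oscillating tableaux, i.e. closed walks
    from the empty partition that add or remove one box at each step: the second
    class bounds the first row by [p], and the first class bounds the number of
    rows by [p], which transposition exchanges with a bound on the first row.

    Oscillating tableaux are matched with fixed point free involutions by a
    triangular growth diagram (Sundaram, Fomin; Chen, Deng, Du, Stanley, Yan).
    Going down from time [2N], the partition at time [t] is the shape of the RSK
    tableau of the arcs open at time [t], inserted by decreasing closer.  Its first
    row is the largest number of nested arcs open at [t], and [k] nested arcs are
    the same thing as a decreasing subsequence of length [2k].

    A tableau is encoded as the word giving the row of each entry.  Insertion
    then needs no columns: it is a single left-to-right scan, reversible letter by
    letter, and the tableau condition becomes the Yamanouchi condition. *)

Require Import Defs.
From mathcomp Require Import all_boot all_order all_fingroup all_algebra.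
From mathcomp Require Import zify.

Set Implicit Arguments.
Unset Strict Implicit.
Unset Printing Implicit Defensive.

(** * Yamanouchi words and reversible insertion *)

Definition cnt (w : nat -> nat) (n k : nat) : nat := \sum_(i < n) (w i == k).

Lemma cnt0 w k : cnt w 0 k = 0.
Proof. by rewrite /cnt big_ord0. Qed.

Lemma cntS w n k : cnt w n.+1 k = cnt w n k + (w n == k).
Proof. by rewrite /cnt big_ord_recr. Qed.

Lemma eq_cnt w w' n k : (forall i, i < n -> w i = w' i) -> cnt w n k = cnt w' n k.
Proof. by move=> e; apply: eq_bigr => i _; rewrite e. Qed.

Definition yamanouchi (w : nat -> nat) (n : nat) : Prop :=
  forall j k, j <= n -> cnt w j k.+2 <= cnt w j k.+1.

Lemma yamanouchiS w n :
  yamanouchi w n -> (forall k, cnt w n.+1 k.+2 <= cnt w n.+1 k.+1) -> yamanouchi w n.+1.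
Proof.
by move=> yw le j k; rewrite leq_eqVlt => /orP[/eqP->|] //; rewrite ltnS; exact: yw.
Qed.

Lemma eq_yamanouchi w w' n : (forall i, i < n -> w i = w' i) ->
  yamanouchi w n -> yamanouchi w' n.
Proof.
move=> e yw j k jn; have e' k' : cnt w' j k' = cnt w j k'.
  by apply: eq_cnt => i ij; rewrite e //; lia.
by rewrite !e'; exact: yw.
Qed.

(* Letters: [0] is a blank position and [k.+1] an entry in row [k].  [scan w x i] is
   the row reached by the bumping path when it arrives at position [i], after an
   entry has been inserted at the blank [x]; it starts in state [0], so that
   turning the blank into a [1] is an instance of the bumping rule. *)
Fixpoint scan (w : nat -> nat) (x i : nat) : nat :=
  if i is i'.+1 then
    if i' < x then 0 else if w i' == scan w x i' then (scan w x i').+1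
    else scan w x i'
  else 0.

Definition ins (w : nat -> nat) (x i : nat) : nat :=
  if i < x then w i else if w i == scan w x i then (w i).+1 else w i.

Lemma scan_le w x i : i <= x -> scan w x i = 0.
Proof. by case: i => //= i ->. Qed.

Lemma scanS w x i : x <= i ->
  scan w x i.+1 = if w i == scan w x i then (scan w x i).+1 else scan w x i.
Proof. by move=> xi; rewrite /= ltnNge xi. Qed.

Lemma ins_lt w x i : i < x -> ins w x i = w i.
Proof. by rewrite /ins => ->. Qed.

Lemma ins_ge w x i : x <= i ->
  ins w x i = if w i == scan w x i then (w i).+1 else w i.
Proof. by move=> xi; rewrite /ins ltnNge xi. Qed.

Lemma scan_gt w x i : w x = 0 -> x < i -> 0 < scan w x i.
Proof.
move=> wx; elim: i => // i IH; rewrite ltnS leq_eqVlt => /orP[/eqP <-|xi].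
  by rewrite scanS // wx scan_le // eqxx.
by rewrite scanS ?(ltnW xi) //; case: ifP => // _; exact: IH.
Qed.

Lemma eq_scan w w' x i : (forall j, j < i -> w j = w' j) -> scan w x i = scan w' x i.
Proof.
elim: i => //= i IH e; rewrite IH ?e // => j ji; apply: e; lia.
Qed.

Lemma eq_ins w w' x i : (forall j, j <= i -> w j = w' j) -> ins w x i = ins w' x i.
Proof.
by move=> e; rewrite /ins e // (eq_scan _ (w' := w')) // => j /ltnW /e.
Qed.

Lemma ins_eq0 w x i : w x = 0 -> (ins w x i == 0) = (w i == 0) && (i != x).
Proof.
move=> wx; have [ix|xi] := ltnP i x.
  by rewrite ins_lt // (ltn_eqF ix) andbT.
rewrite ins_ge //; move: xi; rewrite leq_eqVlt => /orP[/eqP <-|xi].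
  by rewrite wx scan_le // !eqxx.
rewrite (gtn_eqF xi) andbT; have := scan_gt wx xi; case: (w i =P scan w x i) => // <-.
by case: (w i).
Qed.

(** A bumped letter [c] becomes [c.+1] exactly as the state passes from [c] to [c.+1], so the prefix
    carries one surplus letter, equal to the current state. *)
Lemma cnt_ins w x n k : cnt (ins w x) n k.+1 = cnt w n k.+1 + (scan w x n == k.+1).
Proof.
elim: n => [|n IH]; first by rewrite !cnt0.
rewrite !cntS IH; have [nx|xn] := ltnP n x.
  by rewrite ins_lt // !scan_le ?(ltnW nx) //; lia.
by rewrite ins_ge // scanS //; case: (w n =P scan w x n) => [->|_]; lia.
Qed.

(** By [cnt_ins] only the surplus letter [c] can break the condition. If a bump has just produced
    it, [w] has just gained a letter [c.-1]; otherwise the current letter is not [c], and the bound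
    from one position earlier survives. *)
Lemma yamanouchi_ins w x n : w x = 0 -> yamanouchi w n -> yamanouchi (ins w x) n.
Proof.
move=> wx; elim: n => [|n IH] yw.
  by move=> j k; rewrite leqn0 => /eqP->; rewrite !cnt0.
have yn : yamanouchi w n by move=> j k jn; apply: yw; lia.
have y' := IH yn; apply: yamanouchiS => // k.
have := y' n k (leqnn n); have := yw n k (leqnSn n); have := yw n.+1 k (leqnn _).
have := y' n k.+1 (leqnn n); have := yw n k.+1 (leqnSn n).
rewrite !cnt_ins !cntS; have [nx|xn] := ltnP n x.
  by rewrite !scan_le ?(ltnW nx) //; lia.
by rewrite scanS //; case: (w n =P scan w x n) => [->|?]; lia.
Qed.

(** The entry inserted at [x] bumps the first letter [1] to its right, so the surplus in the first
    row lasts until that letter is met. *)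
Lemma scan_cnt1 w x i : w x = 0 -> x < i ->
  cnt w i 1 + (scan w x i == 1) = maxn (cnt w i 1) (cnt w x 1).+1.
Proof.
move=> wx; elim: i => // i IH; rewrite ltnS leq_eqVlt => /orP[/eqP <-|xi].
  by rewrite scanS // cntS wx scan_le //=; lia.
move: (IH xi) (scan_gt wx xi); rewrite scanS ?(ltnW xi) // cntS.
by case: (w i =P scan w x i) => [->|?]; lia.
Qed.

(** Reverse insertion: the hypothesis makes the end of row [r] a removable corner, and the bumping
    path is traced back from it to the blank where it began. *)
Lemma ins_surj w' n r : yamanouchi w' n -> cnt w' n r.+2 < cnt w' n r.+1 ->
  exists w x, [/\ x < n, w x = 0, yamanouchi w n, scan w x n = r.+1
               & forall i, i < n -> w' i = ins w x i].
Proof.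
elim: n r => [|n IH] r yw' lt; first by rewrite !cnt0 in lt.
have yn : yamanouchi w' n by move=> j k jn; apply: yw'; lia.
pose ext w a i := if i == n then a else w i : nat.
have extE w a i : i < n -> ext w a i = w i by rewrite /ext; case: eqP => //; lia.
have extn w a : ext w a n = a by rewrite /ext eqxx.
(* The scan is run backwards from the last letter: the induction hypothesis is
   applied in state [r] or, if that letter was bumped, in state [r.-1]. *)
have main w x a : x < n.+1 -> ext w a x = 0 -> yamanouchi w n ->
    scan (ext w a) x n.+1 = r.+1 ->
    (forall i, i < n.+1 -> w' i = ins (ext w a) x i) ->
  exists w x, [/\ x < n.+1, w x = 0, yamanouchi w n.+1, scan w x n.+1 = r.+1
               & forall i, i < n.+1 -> w' i = ins w x i].
  move=> xn wx yw bw e; exists (ext w a), x; split => //.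
  apply: yamanouchiS; first by apply: eq_yamanouchi yw => i /extE ->.
  move=> k; have := yw' n.+1 k (leqnn _); move: lt.
  by rewrite !(eq_cnt _ e) !cnt_ins bw; case: (k =P r) => [->|]; lia.
have [e|ne] := eqVneq (w' n) r.+1; last first.
  have [w [x [xn wx yw bw ew]]] : exists w x, [/\ x < n, w x = 0, yamanouchi w n,
      scan w x n = r.+1 & forall i, i < n -> w' i = ins w x i].
    by apply: IH => //; move: lt; rewrite !cntS (negbTE ne); lia.
  have bx : scan (ext w (w' n)) x n = r.+1 by rewrite -bw; apply: eq_scan => j /extE.
  apply: (main w x (w' n)) => //; first lia.
  - by rewrite extE.
  - by rewrite scanS ?(ltnW xn) // extn bx (negbTE ne).
  move=> i; rewrite ltnS leq_eqVlt => /orP[/eqP->|lin].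
    by rewrite ins_ge ?(ltnW xn) // extn bx (negbTE ne).
  by rewrite ew //; apply: eq_ins => j ji; rewrite extE //; lia.
(* In row 0 the last letter is the inserted entry itself, so [x = n]; in a later row it was bumped
   there from the row above. *)
case: r lt e main => [|r] lt e main.
  apply: (main w' n 0) => //.
  - by rewrite scanS // extn scan_le.
  move=> i; rewrite ltnS leq_eqVlt => /orP[/eqP->|lin].
    by rewrite ins_ge // extn scan_le.
  by rewrite ins_lt // extE.
have [w [x [xn wx yw bw ew]]] : exists w x, [/\ x < n, w x = 0, yamanouchi w n,
    scan w x n = r.+1 & forall i, i < n -> w' i = ins w x i].
  by apply: IH => //; have := yw' n.+1 r (leqnn _); rewrite !cntS e; lia.
have bx : scan (ext w r.+1) x n = r.+1 by rewrite -bw; apply: eq_scan => j /extE.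
apply: (main w x r.+1) => //; first lia.
- by rewrite extE.
- by rewrite scanS ?(ltnW xn) // extn bx eqxx.
move=> i; rewrite ltnS leq_eqVlt => /orP[/eqP->|lin].
  by rewrite ins_ge ?(ltnW xn) // extn bx eqxx.
by rewrite ew //; apply: eq_ins => j ji; rewrite extE //; lia.
Qed.

(** The scan is undone from the right: the last letter was bumped exactly when, after insertion, it
    equals the final state. *)
Lemma ins_inj w1 w2 x1 x2 n : x1 < n -> x2 < n -> w1 x1 = 0 -> w2 x2 = 0 ->
  scan w1 x1 n = scan w2 x2 n ->
  (forall i, i < n -> ins w1 x1 i = ins w2 x2 i) ->
  x1 = x2 /\ (forall i, i < n -> w1 i = w2 i).
Proof.
elim: n => // n IH l1 l2 z1 z2 eb ei.
have eS (b : scan w1 x1 n = scan w2 x2 n) (e : w1 n = w2 n) :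
    x1 = x2 /\ (forall i, i < n.+1 -> w1 i = w2 i).
  have e2 i : i < n -> ins w1 x1 i = ins w2 x2 i by move=> h; apply: ei; lia.
  suff [-> e3] : x1 = x2 /\ (forall i, i < n -> w1 i = w2 i).
    split=> // i; rewrite ltnS leq_eqVlt => /orP[/eqP-> //|]; exact: e3.
  (* State 0 at [n] means that the scan has not started, a positive state that it has; equal states
     exclude the mixed cases. *)
  have [g1|g1] := ltnP x1 n; have [g2|g2] := ltnP x2 n.
  - exact: IH.
  - by have := scan_gt z1 g1; rewrite b scan_le.
  - by have := scan_gt z2 g2; rewrite -b scan_le.
  have [E1 E2] : x1 = n /\ x2 = n by lia.
  by split=> [|i h]; [lia | have := e2 i h; rewrite !ins_lt //; lia].
have := ei n (ltnSn n); rewrite !ins_ge //; move: eb; rewrite !scanS //.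
by case: eqP => h1; case: eqP => h2 ? ?; apply: eS; lia.
Qed.

(** * Growth words of a matching *)

Lemma down_ind (T : nat) (P : nat -> Prop) :
  P T -> (forall t, t < T -> P t.+1 -> P t) -> forall t, t <= T -> P t.
Proof.
move=> PT PS t tT; rewrite -(subKn tT).
elim: (T - t) (leq_subr t T) => [|d IH] dT; first by rewrite subn0.
by apply: PS; [lia | rewrite subnSK //; apply: IH; lia].
Qed.

Definition matching (T : nat) (m : nat -> nat) : Prop :=
  forall i, i < T -> [/\ m i < T, m (m i) = i & m i <> i].

(** Openers need no rule: passing from [t.+1] to [t] merely drops the letter at position [t]. *)
Fixpoint back_word (m : nat -> nat) (T d : nat) : nat -> nat :=
  if d is d'.+1 then
    if m (T - d) < T - d then ins (back_word m T d') (m (T - d))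
    else back_word m T d'
  else fun=> 0.

(* The growth word of the arcs opened before [t] and closed at or after [t], built
   downwards from the last time [T]; only its letters at positions [< t] matter. *)
Definition word (m : nat -> nat) (T t : nat) : nat -> nat := back_word m T (T - t).

Definition diagram (m : nat -> nat) (T t k : nat) : nat := cnt (word m T t) t k.+1.

Lemma word_last m T i : word m T T i = 0.
Proof. by rewrite /word subnn. Qed.

Lemma word_closer m T t : t < T -> m t < t ->
  word m T t = ins (word m T t.+1) (m t).
Proof.
by move=> tT mt; rewrite /word -(subnSK tT) /= subnSK // subKn ?(ltnW tT) // mt.
Qed.

Lemma word_opener m T t : t < T -> t <= m t -> word m T t = word m T t.+1.
Proof.
by move=> tT mt; rewrite /word -(subnSK tT) /= subnSK // subKn ?(ltnW tT) // ltnNge mt.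
Qed.

Lemma eq_word T m m' t : (forall i, i < T -> m i = m' i) -> t <= T ->
  word m T t = word m' T t.
Proof.
move=> e tT; elim/(@down_ind T): t / tT => [|t tT IH].
  by rewrite /word subnn.
have et := e t tT; have [ct|ot] := ltnP (m t) t.
  by rewrite (word_closer tT ct) (@word_closer m') // -et // IH.
by rewrite (word_opener tT ot) (@word_opener m') // -et // IH.
Qed.

(** Entries stand at the openers of the arcs open at time [t]; hence an opener is still blank when
    its arc is inserted, as the insertion lemmas require. *)
Lemma word_eq0 T m t i : matching T m -> t <= T -> i < t ->
  (word m T t i == 0) = (m i < t).
Proof.
move=> mm tT; move: i; elim/(@down_ind T): t / tT => [i iT|t tT IH i it].
  by rewrite word_last eqxx; case: (mm i iT) => ->.
have [iT [mi mmi ne] [mt mmt net]] : [/\ i < T, [/\ m i < T, m (m i) = i & m i <> i]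
  & [/\ m t < T, m (m t) = t & m t <> t]] by split; [lia | apply: mm; lia | exact: mm].
have it_mt : m i = t <-> i = m t by split=> [<-|->].
have [ct|ot] := ltnP (m t) t.
  rewrite word_closer // ins_eq0; last by apply/eqP; rewrite IH ?mmt; lia.
  rewrite IH; last lia.
  by case: (i =P m t); lia.
rewrite word_opener // IH; lia.
Qed.

Lemma word_partner T m t : matching T m -> t < T -> m t < t ->
  word m T t.+1 (m t) = 0.
Proof. by move=> mm tT ct; apply/eqP; rewrite (word_eq0 mm); case: (mm t tT); lia. Qed.

Lemma diagram_closer T m t k : matching T m -> t < T -> m t < t ->
  diagram m T t k = diagram m T t.+1 k + (scan (word m T t.+1) (m t) t == k.+1).
Proof.
move=> mm tT ct; rewrite /diagram word_closer // cnt_ins cntS.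
have /eqP-> : word m T t.+1 t == 0 by rewrite (word_eq0 mm); lia.
by rewrite addn0.
Qed.

Lemma diagram_opener T m t k : t < T -> t <= m t ->
  diagram m T t.+1 k = diagram m T t k + (word m T t.+1 t == k.+1).
Proof. by move=> tT ot; rewrite /diagram (word_opener tT ot) cntS. Qed.

Lemma yamanouchi_word T m t : matching T m -> t <= T -> yamanouchi (word m T t) t.
Proof.
move=> mm tT; elim/(@down_ind T): t / tT => [j k _|t tT IH].
  by rewrite !(@eq_cnt _ (fun=> 0)) ?/cnt ?big1 // => i _; rewrite word_last.
have y' : yamanouchi (word m T t.+1) t by move=> j k jt; apply: IH; lia.
have [ct|ot] := ltnP (m t) t; last by rewrite word_opener.
by rewrite word_closer //; apply: yamanouchi_ins => //; exact: word_partner.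
Qed.

(** * Matchings and oscillating tableaux *)

Definition oscillating (T : nat) (l : nat -> nat -> nat) : Prop :=
  [/\ forall k, l 0 k = 0, forall k, l T k = 0,
      forall t k, t <= T -> l t k.+1 <= l t k
    & forall t, t < T -> exists k,
        (forall j, l t.+1 j = l t j + (j == k)) \/
        (forall j, l t j = l t.+1 j + (j == k))].

Lemma diagram_oscillating T m : matching T m -> oscillating T (diagram m T).
Proof.
move=> mm; split=> [k|k|t k tT|t tT].
- exact: cnt0.
- by rewrite /diagram (@eq_cnt _ (fun=> 0)) ?/cnt ?big1 // => i _; rewrite word_last.
- exact: yamanouchi_word.
have [ct|ot] := ltnP (m t) t.
  exists (scan (word m T t.+1) (m t) t).-1; right=> j; rewrite diagram_closer //.
  have := scan_gt (word_partner mm tT ct) ct.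
  by case: scan => //= a _; rewrite eqSS eq_sym.
exists (word m T t.+1 t).-1; left=> j; rewrite diagram_opener //.
have: word m T t.+1 t != 0 by rewrite (word_eq0 mm) //; case: (mm t tT) => ? ? ?; lia.
by case: word => //= a _; rewrite eqSS eq_sym.
Qed.

(** The words are reconstructed upwards from time 0: a gained box gives the new last letter, a lost
    box gives the final state of an insertion, which [ins_inj] undoes, revealing the opener. *)
Lemma diagram_inj T m m' : matching T m -> matching T m' ->
  (forall t k, t <= T -> diagram m T t k = diagram m' T t k) ->
  forall i, i < T -> m i = m' i.
Proof.
move=> mm mm' e.
have main t : t <= T ->
    (forall i, i < t -> word m T t i = word m' T t i) /\
    (forall i, i < t -> m i < i -> m i = m' i).
  elim: t => // t IH tT; have [ew em] := IH (ltnW tT).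
  have bg n (nn : matching T n) (ct : n t < t) := scan_gt (word_partner nn tT ct) ct.
  have wg n (nn : matching T n) (ot : t <= n t) : 0 < word n T t.+1 t.
    by rewrite lt0n (word_eq0 nn) //; case: (nn t tT) => ? ? ?; lia.
  have es k := e t k (ltnW tT); have eS k := e t.+1 k tT.
  have [ct|ot] := ltnP (m t) t; have [ct'|ot'] := ltnP (m' t) t.
  - have [e1 e2] : m t = m' t /\ forall i, i < t -> word m T t.+1 i = word m' T t.+1 i.
      apply: ins_inj => //; try exact: word_partner.
        have := es (scan (word m T t.+1) (m t) t).-1.
        rewrite (diagram_closer _ mm) // (diagram_closer _ mm') // eS.
        rewrite prednK ?bg // eqxx eq_sym.
        by case: eqP => //; lia.
      by move=> i it; rewrite -!word_closer //; exact: ew.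
    split=> i; rewrite ltnS leq_eqVlt => /orP[/eqP->|it] //; [|exact: e2|exact: em].
    have /eqP-> : word m T t.+1 t == 0 by rewrite (word_eq0 mm); lia.
    by apply/esym/eqP; rewrite (word_eq0 mm'); lia.
  (* In the mixed cases one diagram would lose a box while the other gains one. *)
  - have h := diagram_closer (word m' T t.+1 t).-1 mm tT ct; move: h.
    rewrite es eS diagram_opener // prednK ?wg // eqxx; lia.
  - have h := diagram_closer (word m T t.+1 t).-1 mm' tT ct'; move: h.
    rewrite -es -eS diagram_opener // prednK ?wg // eqxx; lia.
  have ewt : word m T t.+1 t = word m' T t.+1 t.
    have := eS (word m T t.+1 t).-1.
    rewrite !diagram_opener // es prednK ?wg // eqxx eq_sym.
    by case: eqP => //; lia.
  split=> i; rewrite ltnS leq_eqVlt => /orP[/eqP->|it] //; [|lia|exact: em].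
  by rewrite -!word_opener //; exact: ew.
move=> i iT; have [_ em] := main T (leqnn T); have [_ em'] := main T (leqnn T).
have [mi mmi ne] := mm _ iT; have [mi' mmi' ne'] := mm' _ iT.
(* An opener is handled through its closer [m i], where the matchings already agree. *)
have [ci|oi] := ltnP (m i) i; first exact: em.
have h : i = m' (m i) by rewrite -em // ?mmi; lia.
by rewrite {2}h; case: (mm' _ mi).
Qed.

(** The inverse construction, upwards in time: a gained box appends its letter; a lost box is
    removed by [ins_surj], and the blank it leaves is the opener of the arc closed at that time. *)
Lemma diagram_surj T l : oscillating T l ->
  exists2 m, matching T m & forall t k, t <= T -> diagram m T t k = l t k.
Proof.
case=> l0 lT lpart lstep.
(* An arc opened before [t] but not yet closed is encoded by a fixed point of [m]. *)
have main t : t <= T -> exists (W : nat -> nat -> nat) (m : nat -> nat),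
    [/\ forall i, i < t -> m i < t /\ m (m i) = i,
        forall i, i < t -> (m i == i) = (W t i != 0),
        yamanouchi (W t) t,
        forall s k, s <= t -> cnt (W s) s k.+1 = l s k
      & forall s i, i < s -> s < t ->
          W s i = if m s < s then ins (W s.+1) (m s) i else W s.+1 i].
  elim: t => [_|t IH tT].
    exists (fun _ _ => 0), id; split=> //.
    by move=> s k; rewrite leqn0 => /eqP->; rewrite cnt0 l0.
  have [W [m [mb mW yW Wl We]]] := IH (ltnW tT).
  pose upd w s := if s == t.+1 then w else W s.
  have updE w s : s <= t -> upd w s = W s by rewrite /upd; case: eqP => //; lia.
  have updS w : upd w t.+1 = w by rewrite /upd eqxx.
  have yl w : yamanouchi w t -> (forall k, cnt w t.+1 k.+1 = l t.+1 k) ->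
      yamanouchi w t.+1 /\ forall s k, s <= t.+1 -> cnt (upd w s) s k.+1 = l s k.
    move=> yw wl; split=> [|s k]; first by apply: yamanouchiS => // k; rewrite !wl lpart.
    rewrite leq_eqVlt => /orP[/eqP->|]; first by rewrite updS.
    by rewrite ltnS => st; rewrite updE // Wl.
  have [k [lk|lk]] := lstep t tT.
    pose w i := if i == t then k.+1 else W t i.
    have wE i : i < t -> w i = W t i by rewrite /w; case: eqP => //; lia.
    have wt : w t = k.+1 by rewrite /w eqxx.
    have [yw wl] : yamanouchi w t.+1 /\
        forall s k, s <= t.+1 -> cnt (upd w s) s k.+1 = l s k.
      apply: yl; first by apply: eq_yamanouchi yW => i /wE.
      by move=> j; rewrite cntS (eq_cnt _ wE) Wl // lk wt eqSS eq_sym.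
    exists (upd w), (fun i => if i == t then t else m i); rewrite updS.
    split=> // [i|i|s i si].
    - rewrite ltnS leq_eqVlt; case: (i =P t) => [->|_ /= /mb[mi mmi]].
        by rewrite eqxx.
      by rewrite (ltn_eqF mi) mmi; lia.
    - rewrite ltnS leq_eqVlt; case: (i =P t) => [->|_ /= it]; first by rewrite eqxx wt.
      by rewrite mW // wE.
    rewrite ltnS leq_eqVlt => /orP[/eqP es|st].
      by rewrite es updS updE // eqxx ltnn wE // -es.
    by rewrite (ltn_eqF st) !updE ?(ltnW st) //; exact: We.
  have [w [x [xt wx yw sw We']]] : exists w x, [/\ x < t, w x = 0, yamanouchi w t,
      scan w x t = k.+1 & forall i, i < t -> W t i = ins w x i].
    apply: ins_surj => //; rewrite !Wl // !lk eqxx.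
    by have := lpart t.+1 k tT; case: eqP; lia.
  pose w' i := if i == t then 0 else w i.
  have wE i : i < t -> w' i = w i by rewrite /w'; case: eqP => //; lia.
  have wt : w' t = 0 by rewrite /w' eqxx.
  have [yw' wl] : yamanouchi w' t.+1 /\
      forall s k, s <= t.+1 -> cnt (upd w' s) s k.+1 = l s k.
    apply: yl; first by apply: eq_yamanouchi yw => i /wE.
    move=> j; rewrite cntS (eq_cnt _ wE) wt addn0; have := lk j.
    by rewrite -Wl // (eq_cnt _ We') cnt_ins sw eqSS eq_sym => /addIn.
  have mx : m x = x by apply/eqP; rewrite mW // We' // ins_eq0 // eqxx andbF.
  exists (upd w'), (fun i => if i == t then x else if i == x then t else m i).
  rewrite updS; split=> // [i|i|s i si].
  - rewrite ltnS leq_eqVlt; case: (i =P t) => [->|_ /= /[dup] it /mb[mi mmi]].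
      by rewrite eqxx (ltn_eqF xt); lia.
    case: (i =P x) => [->|ix]; first by rewrite eqxx.
    rewrite (ltn_eqF mi) mmi; case: (m i =P x) => [e|_]; last lia.
    by case: ix; rewrite -mmi e mx.
  - rewrite ltnS leq_eqVlt; case: (i =P t) => [->|_ /= it].
      by rewrite wt (ltn_eqF xt).
    rewrite wE //; case: (i =P x) => [->|ix]; first by rewrite wx (gtn_eqF xt).
    by rewrite mW // We' // ins_eq0 // (introF eqP ix) andbT.
  rewrite ltnS leq_eqVlt => /orP[/eqP es|st].
    rewrite es updS updE // eqxx xt We' -?es //; apply: eq_ins => j ji.
    by rewrite wE //; lia.
  rewrite (ltn_eqF st) !updE ?(ltnW st) // We //.
  case: (s =P x) => [->|//]; by rewrite mx ltnn ltnNge (ltnW xt).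
have [W [m [mb mW yW Wl We]]] := main T (leqnn T).
(* The final shape is empty, so the last word is blank and no arc remains open. *)
have W0 i : i < T -> W T i = 0.
  move=> iT; case e: (W T i) => [//|k]; have := Wl T k (leqnn T).
  by rewrite lT /cnt (bigD1 (Ordinal iT)) //= e eqxx.
have mm : matching T m.
  move=> i iT; have [mi mmi] := mb i iT; split=> //; apply/eqP.
  by rewrite mW // W0.
exists m => // t k tT; rewrite -Wl //; apply: eq_cnt.
elim/(@down_ind T): t / tT => [i iT|t tT IH i it]; first by rewrite word_last W0.
rewrite We //; have [ct|ot] := ltnP (m t) t; last first.
  by rewrite word_opener //; apply: IH; lia.
by rewrite word_closer //; apply: eq_ins => j ji; apply: IH; lia.
Qed.

(** * The first row and nested arcs *)

(** Lists sorted by this relation run from the innermost arc outwards. *)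
Definition nested (m : nat -> nat) : rel nat := fun i j => (j < i) && (m i < m j).

Lemma nested_trans m : transitive (nested m).
Proof. by move=> b a c; rewrite /nested; lia. Qed.

(* A new arc is inserted when its closer is the smallest so far, so it can only be
   the innermost arc of a nesting; [scan_cnt1] is the same recursion for the
   number of entries in the first row. *)
Lemma nestingP T m t i k : matching T m -> t <= T -> i <= t ->
  k <= cnt (word m T t) i 1 <->
  exists s, [/\ size s = k, sorted (nested m) s
              & all (fun x => (x < i) && (t <= m x)) s].
Proof.
move=> mm tT; move: i k; elim/(@down_ind T): t / tT => [i k iT|t tT IH i k it].
  rewrite (@eq_cnt _ (fun=> 0)); last by move=> *; rewrite word_last.
  rewrite {1}/cnt big1 // leqn0; split=> [/eqP->|[[|a s] [<- //= _]]].
    by exists [::].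
  by case/andP=> /andP[ai]; case: (mm a) => //; lia.
have [mt mmt net] := mm t tT.
have [ct|ot] := ltnP (m t) t; last first.
  rewrite word_opener // IH; last lia.
  split=> -[s [ss so al]]; exists s; split=> //; apply: sub_all al => x.
    by lia.
  move=> /andP[xi]; rewrite xi leq_eqVlt => /orP[/eqP e|//].
  have [|_ mmx _] := mm x; first lia.
  by move: ot; rewrite e mmx; lia.
pose x := m t; have wx : word m T t.+1 x = 0 by exact: word_partner.
(* A chain either avoids the new arc or has it as its head, followed by arcs opened before [x]. *)
have E : k <= cnt (word m T t) i 1 <-> k <= cnt (word m T t.+1) i 1 \/
    x < i /\ k <= (cnt (word m T t.+1) x 1).+1.
  rewrite word_closer // cnt_ins -/x; have [xi|ix] := ltnP x i.
    by rewrite scan_cnt1 //; lia.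
  rewrite scan_le //= addn0; split=> [|[//|[xi]]]; [by left | lia].
rewrite E; split=> [[/IH[|s [ss so al]]|[xi]]|].
- lia.
- by exists s; split=> //; apply: sub_all al => y; lia.
- case: k {E} => [_|k]; first by exists [::].
  rewrite ltnS => /IH[|s [ss so al]]; first lia.
  exists (x :: s); rewrite /= ss xi mmt leqnn; split=> //.
    rewrite (path_sortedE (@nested_trans m)) so andbT; apply: sub_all al => y.
    by rewrite /nested mmt.
  by apply: sub_all al => y; lia.
case=> -[[<- _ _]|a s [<- so]]; first by left.
move=> /= /andP[/andP[ai am] al]; move: so => /=.
rewrite (path_sortedE (@nested_trans m)) => /andP[as' so].
(* Only the head can close at [t], since the other arcs close later. *)
have [e|ne] := eqVneq (m a) t.
  have ea : a = x by rewrite /x -e; case: (mm a) => //; lia.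
  right; split; first by rewrite -ea.
  rewrite ltnS IH; last lia.
  exists s; split=> //; apply/allP=> y ys.
  by have := allP as' y ys; rewrite /nested /= e ea; lia.
left; rewrite IH; last lia.
exists (a :: s); split=> //=; first by rewrite (path_sortedE (@nested_trans m)) as'.
rewrite ai /=; apply/andP; split; first lia.
by apply/allP=> y ys; have := allP as' y ys; have := allP al y ys; rewrite /nested; lia.
Qed.

(** * Size bounds and transposition of oscillating tableaux *)

Lemma sum_eq_ord K k : \sum_(j < K) (nat_of_ord j == k) = (k < K).
Proof.
elim: K => [|K IH]; first by rewrite big_ord0.
by rewrite big_ord_recr /= IH; lia.
Qed.

Lemma sum_add_eq K (r r' : nat -> nat) k : (forall j, r' j = r j + (j == k)) ->
  \sum_(j < K) r' j = \sum_(j < K) r j + (k < K).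
Proof.
by move=> e; rewrite -sum_eq_ord -big_split; apply: eq_bigr => j _; rewrite e.
Qed.

Lemma row_antitone (r : nat -> nat) : (forall k, r k.+1 <= r k) ->
  forall i j, i <= j -> r j <= r i.
Proof.
move=> h i j /subnK <-; elim: (j - i) => // d IH.
by rewrite addSn; apply: leq_trans (h _) IH.
Qed.

(** The tableau is empty at both ends, and a step changes the number of boxes in the first [K] rows
    by at most one. *)
Lemma oscillating_sum T l K t : oscillating T l -> t <= T ->
  \sum_(j < K) l t j <= minn t (T - t).
Proof.
case=> l0 lT _ ls tT; rewrite leq_min; apply/andP; split.
  elim: t tT => [_|t IH tT]; first by rewrite big1.
  have [k [/(@sum_add_eq K)|/(@sum_add_eq K)]] := ls t tT; have := IH (ltnW tT); lia.
elim/(@down_ind T): t / tT => [|t tT IH]; first by rewrite big1.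
by have [k [/(@sum_add_eq K)|/(@sum_add_eq K)]] := ls t tT; lia.
Qed.

(** A nonempty row [k] forces [k.+1] boxes. For [T = 2 * N] this leaves at most [N] rows, so [N]
    walkers can carry them all. *)
Lemma oscillating_rows T l t k : oscillating T l -> t <= T ->
  0 < l t k -> k < minn t (T - t).
Proof.
move=> osc tT lk; apply: leq_trans (oscillating_sum k.+1 osc tT).
rewrite -[X in X <= _](card_ord k.+1) -sum1_card; apply: leq_sum => j _.
apply: leq_trans lk _; apply: row_antitone; last by rewrite -ltnS.
by move=> i; case: osc => _ _ /(_ t i tT).
Qed.

Lemma oscillating_cols T l t : oscillating T l -> t <= T -> l t 0 <= T.
Proof.
move=> osc tT; have := oscillating_sum 1 osc tT.
by rewrite big_ord_recl big_ord0 /=; lia.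
Qed.

(** The conjugate partition; summing over [T] rows is enough, since by [oscillating_rows] the rows
    from [T] on are empty. *)
Definition transpose (T : nat) (r : nat -> nat) (k : nat) : nat :=
  \sum_(j < T) (k < r j).

Lemma eq_transpose T r r' k : (forall j, r j = r' j) ->
  transpose T r k = transpose T r' k.
Proof. by move=> e; apply: eq_bigr => j _; rewrite e. Qed.

Lemma sum_pred_le T (P : nat -> bool) : \sum_(j < T) P j <= T.
Proof.
rewrite -[X in _ <= X](card_ord T) -sum1_card; apply: leq_sum => j _.
by case: (P j).
Qed.

Lemma ltn_sum_pred T (P : nat -> bool) i : (forall j, P j.+1 -> P j) -> i < T ->
  (i < \sum_(j < T) P j) = P i.
Proof.
move=> Pd; have PP a b : a <= b -> P b -> P a.
  by move=> /subnK <-; elim: (b - a) => // d IH; rewrite addSn => /Pd.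
elim: T => // T IH; rewrite ltnS big_ord_recr /= leq_eqVlt => /orP[/eqP->|iT].
  case PT: (P T); last by rewrite addn0 ltnNge sum_pred_le.
  rewrite (eq_bigr (fun=> 1)) => [|j _]; last by rewrite (PP j T) // ltnW.
  by rewrite sum1_card card_ord addn1 ltnSn.
case PT: (P T); last by rewrite addn0 IH.
by have := IH iT; rewrite (PP i T) ?(ltnW iT) // addn1; exact: leqW.
Qed.

Lemma sum_ltn T a : \sum_(j < T) (j < a) = minn T a.
Proof.
elim: T => [|T IH]; first by rewrite big_ord0 min0n.
by rewrite big_ord_recr /= IH; lia.
Qed.

Lemma transposeK T r k : (forall k, r k.+1 <= r k) -> r 0 <= T -> r T = 0 ->
  transpose T (transpose T r) k = r k.
Proof.
move=> rd r0 rT; have anti := row_antitone rd; have [kT|Tk] := ltnP k T.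
  rewrite /transpose (eq_bigr (fun j : 'I_T => nat_of_bool (j < r k))) => [|j _].
    by rewrite sum_ltn; have := anti 0 k isT; lia.
  rewrite (@ltn_sum_pred T (fun i => j < r i)) // => i.
  by have := rd i; lia.
have -> : r k = 0 by have := anti T k Tk; lia.
rewrite /transpose big1 // => j _.
by have := sum_pred_le T (fun i => j < r i); lia.
Qed.

(** The added box lies in row [k] and column [r k]. *)
Lemma transpose_add T r r' k i : (forall j, r' j = r j + (j == k)) -> k < T ->
  transpose T r' i = transpose T r i + (i == r k).
Proof.
move=> e kT; rewrite /transpose (bigD1 (Ordinal kT)) //=.
rewrite [in RHS](bigD1 (Ordinal kT)) //= e eqxx.
rewrite (eq_bigr (fun j : 'I_T => nat_of_bool (i < r j))) => [|j]; first lia.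
by rewrite -val_eqE /= e => /negbTE ->; rewrite addn0.
Qed.

Lemma transpose_oscillating T l : oscillating T l ->
  oscillating T (fun t => transpose T (l t)).
Proof.
move=> osc; have [l0 lT ld ls] := osc; split=> [k|k|t k tT|t tT].
- by rewrite /transpose big1 // => j _; rewrite l0.
- by rewrite /transpose big1 // => j _; rewrite lT.
- by apply: leq_sum => j _; lia.
(* The minimum is the column of the box, whether added or removed. *)
have [k [e|e]] := ls t tT; exists (minn (l t k) (l t.+1 k)); [left|right] => j.
  have kT : k < T by have := oscillating_rows osc tT (k := k); rewrite e eqxx; lia.
  by rewrite (transpose_add _ e kT) e eqxx; congr (_ + (_ == _)); lia.
have kT : k < T by have := oscillating_rows osc (ltnW tT) (k := k); rewrite e eqxx; lia.
by rewrite (transpose_add _ e kT) e eqxx; congr (_ + (_ == _)); lia.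
Qed.

Lemma transpose_eq0 T r p : 0 < T -> (forall k, r k.+1 <= r k) ->
  (transpose T r p == 0) = (r 0 <= p).
Proof.
move=> T0 rd; apply/idP/idP => [|r0].
  by rewrite /transpose (bigD1 (Ordinal T0)) //=; lia.
apply/eqP; rewrite /transpose big1 // => j _.
by have := row_antitone rd (leq0n j); lia.
Qed.

(** * Walker configurations as oscillating tableaux *)

(** The right-most walker carries row 0: since rows decrease weakly, displacements increase weakly
    to the right and the walkers stay strictly ordered. *)
Definition walk (T m : nat) (l : nat -> nat -> nat) : trajectory T m :=
  [ffun t : 'I_T.+1 => [ffun i : 'I_m => Posz (i.+1 + l t (m - i.+1))]].

Lemma walkE T m l t i : walk T m l t i = Posz (i.+1 + l t (m - i.+1)).
Proof. by rewrite !ffunE. Qed.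

Lemma eq_walk T m l l' : (forall t k, t <= T -> l t k = l' t k) ->
  walk T m l = walk T m l'.
Proof.
move=> e; apply/ffunP=> t; apply/ffunP=> i; rewrite !walkE e //.
by rewrite -ltnS.
Qed.

Lemma walk_packed_return T m l : oscillating T l ->
  (forall t, t <= T -> l t m = 0) -> packed_return (walk T m l).
Proof.
move=> osc lm; have [l0 lT ld ls] := osc.
have anti t (tT : t <= T) := row_antitone (fun k => ld t k tT).
apply/and3P; split; last 2 first.
- by apply/eqP/ffunP=> i; rewrite walkE ffunE l0 addn0.
- by apply/eqP/ffunP=> i; rewrite walkE ffunE lT addn0.
apply/andP; split.
  apply/forallP=> t; have tT : t <= T by rewrite -ltnS.
  apply/andP; split; first by apply/forallP=> i; rewrite walkE.
  apply/forallP=> i; apply/forallP=> j; apply/implyP=> ij; rewrite !walkE.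
  by have := anti t tT (m - j.+1) (m - i.+1); lia.
apply/forallP=> t; have tT := ltn_ord t.
have [k e] := ls t tT.
(* The row that changes is nonempty before or after the step, hence among the first [m]. *)
have km : k < m.
  rewrite ltnNge; apply/negP=> mk.
  have [t' t'T lk] : exists2 t', t' <= T & 0 < l t' k.
    by case: e => /(_ k) e; [exists t.+1 | exists (nat_of_ord t)]; rewrite ?e ?eqxx; lia.
  by have := anti t' t'T _ _ mk; rewrite lm //; lia.
have im : m - k.+1 < m by lia.
have kE : m - (m - k.+1).+1 = k by lia.
apply/existsP; exists (Ordinal im); rewrite !walkE lift0 /= kE; apply/andP; split.
  by case: e => /(_ k); rewrite eqxx; lia.
apply/forallP=> j; apply/implyP; rewrite -val_eqE /= => ji.
rewrite !walkE lift0 /=; apply/eqP; congr (Posz (_ + _)).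
have jm := ltn_ord j; have jk : (m - j.+1 == k) = false by lia.
by case: e => /(_ (m - j.+1)); rewrite jk addn0.
Qed.

Lemma walk_inj T m l l' : walk T m l = walk T m l' ->
  forall t k, t <= T -> k < m -> l t k = l' t k.
Proof.
move=> /ffunP e t k tT km; have im : m - k.+1 < m by lia.
have tT' : t < T.+1 by [].
have /ffunP/(_ (Ordinal im)) := e (Ordinal tT'); rewrite !walkE /=.
have -> : m - (m - k.+1).+1 = k by lia.
by lia.
Qed.

Lemma walk_displacement T m p l : 0 < m -> (forall k, l 0 k = 0) ->
  rightmost_displacement_le p (walk T m l) <-> (forall t, t <= T -> l t 0 <= p).
Proof.
move=> m0 l0; split=> [/forallP h t tT|h].
  have im : m.-1 < m by lia.
  have tT' : t < T.+1 by [].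
  have /forallP/(_ (Ordinal im)) := h (Ordinal tT'); rewrite !walkE /= l0.
  by rewrite prednK // eqxx subnn /=; lia.
apply/forallP=> t; apply/forallP=> i; apply/implyP=> /eqP im.
by have := h t; rewrite -ltnS ltn_ord !walkE l0 im subnn => /(_ isT); lia.
Qed.

Lemma packed_return_walk T m (w : trajectory T m) : packed_return w ->
  exists2 l, oscillating T l &
    (forall t, t <= T -> l t m = 0) /\ w = walk T m l.
Proof.
case/and3P=> /andP[/forallP adm /forallP step] /eqP w0 /eqP wT.
(* Row [k] is the displacement of the walker with [k] others to its right, whose packed site is
   [m - k]. The truncated subtraction is exact by [pos] below. *)
pose l t k := if insub k is Some i then
  absz (w (inord t) (rev_ord i)) - (m - k) else 0.
have lE t (i : 'I_m) : t <= T -> l t i = absz (w (inord t) (rev_ord i)) - (m - i).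
  by move=> tT; rewrite /l insubT //= => im; do 3 f_equal; apply/val_inj.
have l_ge t k : m <= k -> l t k = 0.
  by move=> mk; rewrite /l insubF // ltnNge mk.
have incr t (i j : 'I_m) : i < j -> (w t i < w t j)%R.
  by have /andP[_ /forallP/(_ i)/forallP/(_ j)/implyP] := adm t.
have pos t (i : 'I_m) : (Posz i.+1 <= w t i)%R.
  case: i => i; elim: i => [|i IH] im;
    have /andP[/forallP/(_ (Ordinal im)) ? _] := adm t => //.
  by have := incr t (Ordinal (ltnW im)) (Ordinal im) (ltnSn i);
    have := IH (ltnW im); rewrite /=; lia.
have wE t i : w t i = Posz (i.+1 + l t (m - i.+1)).
  have tT : t <= T by rewrite -ltnS.
  have := lE t (rev_ord i) tT; rewrite rev_ordK inord_val /= => ->.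
  by have := pos t i; have := ltn_ord i; lia.
have wW : w = walk T m l by apply/ffunP=> t; apply/ffunP=> i; rewrite walkE wE.
have lw t k (km : k < m) : t <= T ->
    exists i : 'I_m, [/\ i = m - k.+1 :> nat & w (inord t) i = Posz (m - k + l t k)].
  move=> tT; exists (rev_ord (Ordinal km)); split=> //.
  by rewrite wE inordK //= ; congr Posz; congr (_ + l _ _); lia.
exists l; last by split=> // t _; exact: l_ge.
split=> [k|k|t k tT|t tT].
- have [km|/l_ge->//] := ltnP k m.
  have [i [ei]] := lw 0 k km isT; have -> : inord 0 = ord0 :> 'I_T.+1.
    by apply/val_inj; rewrite /= inordK.
  by rewrite w0 ffunE; lia.
- have [km|/l_ge->//] := ltnP k m.
  have [i [ei]] := lw T k km (leqnn T); have -> : inord T = ord_max :> 'I_T.+1.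
    by apply/val_inj; rewrite /= inordK.
  by rewrite wT ffunE; lia.
- have [km|/l_ge->//] := ltnP k.+1 m.
  have [i [ei wi]] := lw t _ km tT; have [j [ej wj]] := lw t k (ltnW km) tT.
  by have := incr (inord t) i j; rewrite wi wj; lia.
have /existsP[i /andP[hi /forallP hj]] := step (Ordinal tT).
have ltm := ltn_ord i.
have lstep k : k <> m - i.+1 -> l t.+1 k = l t k.
  move=> ki; have [km|mk] := ltnP k m; last by rewrite !l_ge.
  have jm : m - k.+1 < m by lia.
  have := hj (Ordinal jm); rewrite -val_eqE !wE lift0 /=.
  have -> : m - (m - k.+1).+1 = k by lia.
  have -> : (m - k.+1 != i) by lia.
  by rewrite /=; lia.
exists (m - i.+1); move: hi; rewrite !wE lift0 /= => hi.
have [up|down] : l t.+1 (m - i.+1) = (l t (m - i.+1)).+1 \/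
  l t (m - i.+1) = (l t.+1 (m - i.+1)).+1 by lia.
- by left=> j; case: eqP => [->|/lstep->]; lia.
by right=> j; case: eqP => [->|/lstep->]; lia.
Qed.

(** * Involutions, nestings and decreasing subsequences *)

Definition perm_fun (n : nat) (s : 'S_n) (i : nat) : nat :=
  if insub i is Some j then nat_of_ord (s j) else i.

Lemma perm_funE n (s : 'S_n) (i : 'I_n) : perm_fun s i = s i.
Proof. by rewrite /perm_fun valK. Qed.

Lemma perm_fun_matching n (s : 'S_n) :
  fixed_point_free_involution s -> matching n (perm_fun s).
Proof.
move=> /forallP fs i iN; rewrite -[i]/(nat_of_ord (Ordinal iN)) !perm_funE.
have /andP[/eqP ssi nsi] := fs (Ordinal iN).
split; [exact: ltn_ord | by rewrite ssi|].
by move/val_inj/eqP; apply/negP.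
Qed.

Lemma matching_perm n m : matching n m ->
  exists2 s : 'S_n, fixed_point_free_involution s & forall i, i < n -> perm_fun s i = m i.
Proof.
move=> mm; pose f (i : 'I_n) : 'I_n := insubd i (m i).
have fE i : f i = m i :> nat by rewrite val_insubd; case: (mm i (ltn_ord i)) => ->.
have ff : involutive f.
  by move=> i; apply/val_inj; rewrite /= !fE; case: (mm i (ltn_ord i)).
exists (perm (inv_inj ff)).
  apply/forallP=> i; rewrite !permE ff eqxx -val_eqE /= fE.
  by apply/eqP; case: (mm i (ltn_ord i)).
by move=> i iN; rewrite -[i]/(nat_of_ord (Ordinal iN)) perm_funE permE fE.
Qed.

Lemma seq_ord_of_nat n (s : seq nat) : all (ltn^~ n) s ->
  exists s' : seq 'I_n, s = map val s'.
Proof.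
elim: s => [|x s IH] /=; first by exists [::].
by case/andP=> xn /IH[s' ->]; exists (Ordinal xn :: s').
Qed.

Lemma leq_max_decreasing_length n (s : 'S_n) (a : seq 'I_n) :
  sorted (fun i j : 'I_n => i < j) a -> sorted (fun i j : 'I_n => s j < s i) a ->
  size a <= max_decreasing_length s.
Proof.
move=> ia da; have sa : size a < n.+1.
  rewrite ltnS -[X in _ <= X]card_ord.
  have /card_uniqP <- : uniq a; last exact: max_card.
  by apply: (sorted_uniq _ _ ia) => [j i k|i]; [exact: ltn_trans | exact: ltnn].
rewrite /max_decreasing_length.
apply: (@leq_bigmax_cond _ _ (fun k : 'I_n.+1 => nat_of_ord k) (Ordinal sa)).
by apply/existsP; exists (in_tuple a); rewrite /decreasing_subsequence ia da.
Qed.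

(** Arcs nested at a common time give a decreasing subsequence: openers from the outside in, then
    closers from the inside out. Conversely, [2 * p + 1] decreasing terms already give [p.+1] nested
    arcs. *)
Lemma max_decreasing_lengthP n p (s : 'S_n) : fixed_point_free_involution s ->
  max_decreasing_length s <= 2 * p <->
  (forall t, t <= n -> diagram (perm_fun s) n t 0 <= p).
Proof.
move=> fs; have mm := perm_fun_matching fs; have /forallP fs' := fs.
have ss i : s (s i) = i by have /andP[/eqP] := fs' i.
split=> [le t tn|le].
  rewrite leqNgt; apply/negP => /(nestingP _ mm tn (leqnn t))[u [su so al]].
  have [u' eu] : exists u' : seq 'I_n, u = map val u'.
    by apply: seq_ord_of_nat; apply: sub_all al => x /andP[xt _]; exact: leq_trans tn.
  pose a := rev u' ++ map s u'.
  have sza : size a = p.+1 + p.+1 by rewrite size_cat size_rev size_map -su eu size_map.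
  have so' : sorted (fun i j : 'I_n => (j < i) && (s i < s j)) u'.
    move: so; rewrite eu sorted_map; apply: sub_sorted => i j.
    by rewrite /= /nested !perm_funE.
  have al' : all (fun i : 'I_n => (i < t) && (t <= s i)) u'.
    by move: al; rewrite eu all_map; apply: sub_all => i; rewrite /= perm_funE.
  suff : size a <= max_decreasing_length s by lia.
  have mem y : y \in u' -> (y < t) && (t <= s y) by exact: (allP al').
  apply: leq_max_decreasing_length; rewrite sorted_pairwise.
  - rewrite pairwise_cat -!sorted_pairwise => [|j i k|j i k]; try exact: ltn_trans.
    rewrite rev_sorted sorted_map; apply/and3P; split.
    + apply/allrelP=> y z; rewrite mem_rev => /mem /andP[yt _] /mapP[x /mem xu ->].
      by lia.
    + by apply: sub_sorted so' => i j /andP[].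
    by apply: sub_sorted so' => i j /andP[].
  - by move=> j i k; exact: ltn_trans.
  - rewrite pairwise_cat -!sorted_pairwise => [|j i k|j i k];
      try by move=> h1 h2; exact: ltn_trans h2 h1.
    rewrite rev_sorted sorted_map; apply/and3P; split.
    + apply/allrelP=> y z; rewrite mem_rev => /mem /andP[yt sy] /mapP[x /mem xu ->].
      by rewrite ss; lia.
    + by apply: sub_sorted so' => i j /andP[].
    by apply: sub_sorted so' => i j /andP[]; rewrite /= !ss.
  by move=> j i k h1 h2; exact: ltn_trans h2 h1.
apply/bigmax_leqP => k /existsP[a /andP[ia da]]; rewrite leqNgt; apply/negP => lt.
pose r (i j : 'I_n) := (i < j) && (s j < s i).
have rtr : transitive r by move=> j i l; rewrite /r; lia.
have rab : pairwise r a.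
  rewrite pairwise_relI -!sorted_pairwise ?ia //.
  - by move=> j i l h1 h2; exact: ltn_trans h2 h1.
  by move=> j i l; exact: ltn_trans.
(* More than [2 * p] terms leave [p] before [x] and at least [p] after it. *)
have [b [x [c [ea sb sc]]]] :
    exists b x c, [/\ a = b ++ x :: c :> seq _, size b = p & p <= size c].
  have sa := size_tuple a; have x0 : 'I_n by case: (val a) sa lt => [|x l] // <-.
  exists (take p a), (nth x0 a p), (drop p.+1 a); rewrite -drop_nth ?sa ?cat_take_drop.
    by split=> //; rewrite ?size_take ?size_drop sa; [case: ifP | ]; lia.
  by lia.
move: rab; rewrite ea pairwise_cat /= => /and4P[/allrelP bx rb xc rc].
have contra t u : t <= n -> size u = p.+1 -> sorted (nested (perm_fun s)) u ->
    all (fun y => (y < t) && (t <= perm_fun s y)) u -> False.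
  move=> tn su so al; suff : p.+1 <= diagram (perm_fun s) n t 0 by rewrite ltnNge le.
  by apply/(nestingP _ mm tn (leqnn t)); exists u.
(* [x] is the middle term: one half of the subsequence, or its image under the
   involution, consists of openers of nested arcs. *)
have := ltn_ord x; have := ltn_ord (s x); have [lx|xl xn sn] := ltnP x (s x).
  move=> sn xn; apply: (contra x.+1 (map val (rev (rcons b x)))) => //.
  - by rewrite size_map size_rev size_rcons sb.
  - rewrite sorted_map rev_sorted; apply: (@sub_sorted _ r).
      by move=> i j; rewrite /r /nested /= !perm_funE andbC.
    rewrite sorted_pairwise // -cats1 pairwise_cat rb andbT /=.
    by apply/allrelP=> y z yb; rewrite inE => /eqP->; apply: bx => //; rewrite inE eqxx.
  rewrite all_map; apply/allP=> y; rewrite mem_rev mem_rcons inE /= perm_funE.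
  case/predU1P=> [->|yb]; first by rewrite ltnSn.
  by have := bx y x yb; rewrite inE eqxx /r => /(_ isT); lia.
have {xl} xl : s x < x.
  by rewrite ltn_neqAle xl andbT; have /andP[_] := fs' x; rewrite -val_eqE.
apply: (contra (s x).+1 (map (fun i : 'I_n => val (s i)) (x :: take p c))) => //.
- by rewrite size_map /= size_takel.
- rewrite sorted_map; apply: (@sub_sorted _ r).
    by move=> i j; rewrite /r /nested /= !perm_funE !ss andbC.
  rewrite sorted_pairwise //; apply: (subseq_pairwise (ys := x :: c)).
    by rewrite /= eqxx take_subseq.
  by rewrite /= xc.
rewrite all_map; apply/allP=> y; rewrite inE /= perm_funE ss.
case/predU1P=> [->|/mem_take yc]; first by rewrite ltnSn.
by have := allP xc y yc; rewrite /r; lia.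
Qed.

(** * The two bijections *)

(** The explicit maps go from involutions to walks; the theorem asks for the opposite direction,
    obtained here by choice. *)
Lemma sub_bijective (A : choiceType) (B : eqType) (P : pred A) (Q : pred B)
    (F : A -> B) :
  (forall a, P a -> Q (F a)) ->
  (forall a a', P a -> P a' -> F a = F a' -> a = a') ->
  (forall b, Q b -> exists2 a, P a & F a = b) ->
  exists g : {b | Q b} -> {a | P a}, bijective g.
Proof.
move=> PQ Finj Fsurj.
have ex (b : {b | Q b}) : exists a, P a && (F a == val b).
  by have [a Pa <-] := Fsurj _ (valP b); exists a; rewrite Pa eqxx.
have gP b : P (xchoose (ex b)) by have /andP[] := xchooseP (ex b).
have gE b : F (xchoose (ex b)) = val b by have /andP[_ /eqP] := xchooseP (ex b).
exists (fun b => exist _ (xchoose (ex b)) (gP b)).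
exists (fun a : {a | P a} => exist _ (F (sval a)) (PQ _ (svalP a))) => [b|[a Pa]].
  by apply/val_inj; rewrite /= gE.
by apply/val_inj; set b := (b in xchoose (ex b)); exact: (Finj _ _ (gP b) Pa (gE b)).
Qed.

Theorem proposition1 (N p Nstar : nat) (hN : (1 <= N)%N) (hp : (1 <= p)%N)
    (hNstar : (N <= Nstar)%N) :
  (exists f : first_class N p -> involutions_class N p, bijective f) /\
  (exists g : second_class N Nstar p -> involutions_class N p, bijective g).
Proof.
pose T := 2 * N; have T0 : 0 < T by rewrite /T; lia.
pose L (s : 'S_T) := diagram (perm_fun s) T.
have Losc s : fixed_point_free_involution s -> oscillating T (L s).
  by move=> fs; apply/diagram_oscillating/perm_fun_matching.
have Linj s s' : fixed_point_free_involution s -> fixed_point_free_involution s' ->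
    (forall t k, t <= T -> L s t k = L s' t k) -> s = s'.
  move=> fs fs' e; apply/permP=> i; apply/val_inj; rewrite /= -!perm_funE.
  by apply: (diagram_inj _ _ e) => //; exact: perm_fun_matching.
have Lsurj l : oscillating T l -> exists2 s, fixed_point_free_involution s &
    forall t k, t <= T -> L s t k = l t k.
  case/diagram_surj=> m mm ml; have [s fs sm] := matching_perm mm.
  exists s => // t k tT; rewrite -ml //; apply: eq_cnt => i _.
  by rewrite (eq_word sm).
have anti l t : oscillating T l -> t <= T -> forall k, l t k.+1 <= l t k.
  by case=> _ _ ld _ tT k; exact: ld.
have dE l k t : oscillating T l -> N <= k -> t <= T -> l t k = 0.
  move=> osc Nk tT; have := oscillating_rows osc tT (k := k).
  by rewrite /T in tT *; lia.
have trK l t k : oscillating T l -> t <= T ->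
    transpose T (transpose T (l t)) k = l t k.
  move=> osc tT; apply: transposeK; [exact: anti | exact: oscillating_cols|].
  by apply: dE => //; rewrite /T; lia.
split.
(* First class: [p] walkers carry [p] rows, whereas the diagram has its first row bounded by [p], so
   it is transposed. *)
- apply: (@sub_bijective 'S_T (trajectory T p) _ _
    (fun s => walk T p (fun t => transpose T (L s t)))).
  + move=> s /andP[/[dup] fs /Losc osc] /(max_decreasing_lengthP _ fs) le.
    apply: walk_packed_return; first exact: transpose_oscillating.
    by move=> t tT; apply/eqP; rewrite transpose_eq0 ?le //; exact: anti.
  + move=> s s' /andP[/[dup] fs /Losc osc] /(max_decreasing_lengthP _ fs) le.
    move=> /andP[/[dup] fs' /Losc osc'] /(max_decreasing_lengthP _ fs') le' /walk_inj e.
    apply: Linj => // t k tT; rewrite -(trK _ _ _ osc) // -(trK _ _ _ osc') //.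
    (* The walkers do not show the rows from [p] on, but these vanish in both tableaux. *)
    apply: eq_transpose => j; have [jp|pj] := ltnP j p; first exact: e.
    have z l : oscillating T l -> l t 0 <= p -> transpose T (l t) j = 0.
      move=> ol lp; apply/eqP; rewrite transpose_eq0 ?(leq_trans lp) //; exact: anti.
    by rewrite !z // ?le ?le'.
  move=> w /packed_return_walk[l osc [lp ->]].
  have osc' := transpose_oscillating osc; have [s fs Ls] := Lsurj _ osc'.
  exists s; last first.
    apply: eq_walk => t k tT; rewrite -[RHS](trK _ _ _ osc) //.
    by apply: eq_transpose => j; rewrite Ls.
  apply/andP; split=> //; apply/max_decreasing_lengthP => // t tT.
  rewrite -[diagram _ _ _ _]/(L s t 0) Ls // -(transpose_eq0 _ T0) ?trK ?lp //.
  exact: (anti _ _ osc').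
(* Second class: the walkers show every row, and the first row is the displacement of the right-most
   one. *)
apply: (@sub_bijective 'S_T (trajectory T Nstar) _ _ (fun s => walk T Nstar (L s))).
- move=> s /andP[/[dup] fs /Losc osc] /(max_decreasing_lengthP _ fs) le.
  apply/andP; split; first by apply: walk_packed_return => // t tT; exact: dE.
  apply/walk_displacement => //; first lia.
  by case: osc.
- move=> s s' /andP[fs _] /andP[fs' _] /walk_inj e; apply: Linj => // t k tT.
  have [kN|Nk] := ltnP k Nstar; first exact: e.
  by rewrite !dE //; (exact: Losc || lia).
move=> w /andP[/packed_return_walk[l osc [_ ->]] disp].
have [s fs Ls] := Lsurj l osc; exists s; last by apply: eq_walk.
have l0 k : l 0 k = 0 by case: osc.
apply/andP; split=> //; apply/max_decreasing_lengthP => // t tT.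
rewrite -[diagram _ _ _ _]/(L s t 0) Ls //.
have m0 : 0 < Nstar by lia.
by have [/(_ disp) le _] := @walk_displacement T Nstar p l m0 l0; exact: le.
Qed.
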